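(* Fix $c>0$, $\theta_i>0$ and $\bar\sigma^2>0$. For a distribution of noise variances $(p_\ell,\sigma_\ell^2)_{\ell=1}^L$ let $A$, $B_i$, $\alpha$, $\beta_i$ and the asymptotic PCA amplitude $T$, asymptotic subspace recovery $R$ and asymptotic coefficient recovery $S$ be as defined in the context. Among all distributions of noise variances having average noise variance $p_1\sigma_1^2+\cdots+p_L\sigma_L^2=\bar\sigma^2$ and for which $A(\beta_i)>0$, homoscedastic noise (i.e., $\sigma_1^2=\cdots=\sigma_L^2=\bar\sigma^2$) produces the best asymptotic PCA amplitude, subspace recovery and coefficient recovery. Namely, whenever this family of distributions is nonempty, homoscedastic noise minimizes $T$ (and hence the positive bias $T/\theta_i^2$ of the asymptotic squared PCA amplitude relative to $\theta_i^2$), maximizes $R$, and maximizes $S$ over the family.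
   Context: A distribution of noise variances consists of an integer $L\ge1$, noise variances $\sigma_1^2,\dots,\sigma_L^2>0$ and proportions $p_1,\dots,p_L>0$ with $p_1+\cdots+p_L=1$. Here $c$ is the limiting sample-to-dimension ratio and $\theta_i$ is the $i$th subspace amplitude. Define $$A(x) = 1-c \sum_{\ell=1}^L \frac{p_\ell \sigma_\ell^4}{(x-\sigma_\ell^2)^2}, \qquad B_i(x) = 1-c\,\theta_i^2 \sum_{\ell=1}^L \frac{p_\ell}{x-\sigma_\ell^2},$$ and let $\alpha$ and $\beta_i$ be the largest real roots of $A(x)$ and $B_i(x)$, respectively; $B_i'$ is the derivative of $B_i$. The asymptotic (squared) PCA amplitude, asymptotic subspace recovery and asymptotic coefficient recovery (the almost sure limits, for data with these parameters, of the squared $i$th PCA amplitude $\hat\theta_i^2$, of the squared cosine principal angle between the $i$th principal component and the span of the true basis vectors with amplitude $\theta_i$, and of the analogous squared cosine for the normalized score vector and the true coefficient vectors) are $$T=\frac{1}{c}\max(\alpha,\beta_i)\left\{1+c\sum_{\ell=1}^L\frac{p_\ell\sigma_\ell^2}{\max(\alpha,\beta_i)-\sigma_\ell^2}\right\},\qquad R=\frac{A(\beta_i)}{\beta_iB_i'(\beta_i)},\qquad S=\frac{A(\beta_i)}{c\{\beta_i+(1-c)\theta_i^2\}B_i'(\beta_i)}.$$ *)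

(* Defs.v *)
From mathcomp Require Import all_boot all_order all_algebra.
From mathcomp Require Import all_classical all_reals all_analysis.

Set Implicit Arguments.
Unset Strict Implicit.
Unset Printing Implicit Defensive.

Import Order.TTheory GRing.Theory Num.Theory.
Import numFieldNormedType.Exports.

Local Open Scope classical_set_scope.
Local Open Scope ring_scope.

(* [var d l] is the variance sigma_l^2, so that sigma_l^4 is [var d l ^+ 2].
   The variances need not be distinct. *)
Record noise_distr (R : realType) := NoiseDistr {
  levels : nat;
  prop : 'I_levels -> R;
  var : 'I_levels -> R;
  levels_gt0 : (0 < levels)%N;
  prop_gt0 : forall l, 0 < prop l;
  var_gt0 : forall l, 0 < var l;
  sum_prop : \sum_(l < levels) prop l = 1
}.

Arguments levels {R} _.
Arguments prop {R} _ _.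
Arguments var {R} _ _.

Definition avg_var (R : realType) (d : noise_distr R) : R :=
  \sum_(l < levels d) prop d l * var d l.

Definition homoscedastic (R : realType) (s : R) (d : noise_distr R) : Prop :=
  forall l, var d l = s.

(* Below, c is the limiting sample-to-dimension ratio and theta the amplitude of
   the subspace component under consideration. *)
Definition Afun (R : realType) (c : R) (d : noise_distr R) (x : R) : R :=
  1 - c * \sum_(l < levels d) prop d l * var d l ^+ 2 / (x - var d l) ^+ 2.

Definition Bfun (R : realType) (c theta : R) (d : noise_distr R) (x : R) : R :=
  1 - c * theta ^+ 2 * \sum_(l < levels d) prop d l / (x - var d l).

(* A and B are rational functions with poles at the variances.  Since division
   by zero returns zero, they could vanish spuriously there; a root is therefore
   required not to be a pole. *)
Definition real_root (R : realType) (d : noise_distr R) (f : R -> R) (x : R)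
    : Prop :=
  (forall l, x != var d l) /\ f x = 0.

(* The default value 0 is never used for A and B when 0 < c and 0 < theta:
   both tend to -oo on the right of the largest variance, to 1 at +oo, and are
   increasing in between. *)
Definition largest_real_root (R : realType) (d : noise_distr R) (f : R -> R)
    : R :=
  xget 0 [set x | real_root d f x /\ forall y, real_root d f y -> y <= x].

Definition alpha (R : realType) (c : R) (d : noise_distr R) : R :=
  largest_real_root d (Afun c d).

Definition beta (R : realType) (c theta : R) (d : noise_distr R) : R :=
  largest_real_root d (Bfun c theta d).

(* Squared quantities: the almost sure limits of the squared PCA amplitude and of
   the squared cosines measuring subspace and coefficient recovery. *)
Definition pca_amplitude (R : realType) (c theta : R) (d : noise_distr R) : R :=
  let m := Num.max (alpha c d) (beta c theta d) in
  c^-1 * m * (1 + c * \sum_(l < levels d) prop d l * var d l / (m - var d l)).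

Definition subspace_recovery (R : realType) (c theta : R) (d : noise_distr R)
    : R :=
  let b := beta c theta d in
  Afun c d b / (b * derive1 (Bfun c theta d) b).

Definition coef_recovery (R : realType) (c theta : R) (d : noise_distr R) : R :=
  let b := beta c theta d in
  Afun c d b / (c * (b + (1 - c) * theta ^+ 2) * derive1 (Bfun c theta d) b).

Definition admissible (R : realType) (c theta s : R) (d : noise_distr R)
    : Prop :=
  avg_var d = s /\ 0 < Afun c d (beta c theta d).

(* Main.v *)
(** Write t = theta^2, b = beta, P = sum p/(b - v) and Q = sum p/(b - v)^2.
    Expanding v = b - (b - v) and using P = 1/(ct), which is B(b) = 0, turns T, R
    and S into functions of b and Q alone; T does not involve Q, while R and S
    are decreasing in Q.  Jensen's inequality gives b >= s + ct and
    Q >= 1/(ct)^2, both with equality for homoscedastic noise.  With Q replaced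
    by 1/(ct)^2, the bounds on R and S are decreasing in b on b >= ct, and T is
    increasing there.  In the same way A(b) <= 1 - (b - ct)^2/(ct^2), so
    positivity of A(b) for one distribution implies it for homoscedastic noise. *)
Require Import Defs.
From mathcomp Require Import all_boot all_order all_algebra.
From mathcomp Require Import all_classical all_reals all_analysis.
From mathcomp Require Import ring lra.

Import Order.TTheory GRing.Theory Num.Theory.
Import numFieldNormedType.Exports.

Local Open Scope ring_scope.

(** * Inverse moments of the gaps, and the derivative of B *)

(** Away from the variances, [k = 1] gives the Cauchy transform of the noise distribution and
    [k = 2] minus its derivative; at [beta] these are the P and Q of the overview. *)
Definition inv_moment {R : realType} (k : nat) (d : noise_distr R) (x : R) : R :=
  \sum_(l < levels d) prop d l * (x - var d l)^-1 ^+ k.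

Lemma exists_max_var (R : realType) (d : noise_distr R) :
  exists l0, forall l, var d l <= var d l0.
Proof.
exists [arg max_(l > Ordinal (levels_gt0 d)) var d l]%O.
by move=> l; case: arg_maxP => // i _; apply.
Qed.

Lemma BfunE (R : realType) (c theta : R) (d : noise_distr R) (x : R) :
  Bfun c theta d x = 1 - c * theta ^+ 2 * inv_moment 1 d x.
Proof. by []. Qed.

Lemma is_derive_Bfun (R : realType) (c theta : R) (d : noise_distr R) (x : R) :
  (forall l, x != var d l) ->
  is_derive x 1 (Bfun c theta d) (c * theta ^+ 2 * inv_moment 2 d x).
Proof.
move=> hx.
have hl l : is_derive x 1 (fun y : R => prop d l / (y - var d l))
    (- (prop d l * (x - var d l)^-1 ^+ 2)).
  have h0 : x - var d l != 0 by rewrite subr_eq0.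
  have h1 : is_derive x 1 (fun y : R => y - var d l) 1.
    by apply: is_derive_eq; rewrite subr0.
  have h2 := @is_deriveV R (fun y => y - var d l) x 1 1 h0 h1.
  apply: is_derive_eq.
  rewrite /GRing.scale /=.
  by field.
(* Exposes B as a sum of functions, the shape to which the differentiation rule for finite sums
   applies. *)
have -> : Bfun c theta d =
    (fun y : R => 1 - c * theta ^+ 2 *
      (\sum_(l < levels d) (fun y : R => prop d l / (y - var d l))) y).
  by apply/funext => y; rewrite fct_sumE.
apply: is_derive_eq.
rewrite /inv_moment sumrN /GRing.scale /=; ring.
Qed.

Lemma derive1_Bfun (R : realType) (c theta : R) (d : noise_distr R) (x : R) :
  (forall l, x != var d l) ->
  derive1 (Bfun c theta d) x = c * theta ^+ 2 * inv_moment 2 d x.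
Proof.
move=> hx; have h := is_derive_Bfun R c theta d x hx.
by rewrite derive1E derive_val.
Qed.

(** * Identities, monotonicity and Jensen bounds for the inverse moments *)

Section AboveVariances.
Variables (R : realType) (d : noise_distr R) (x : R).
Hypothesis hx : forall l, var d l < x.

Let gap_gt0 l : 0 < x - var d l. Proof. by rewrite subr_gt0. Qed.
Let gap_neq0 l : x - var d l != 0. Proof. by rewrite gt_eqF. Qed.

Lemma neq_var l : x != var d l.
Proof. by rewrite gt_eqF. Qed.

(** Square [v / (x - v) = x / (x - v) - 1] and average; the weights sum to 1. *)
Lemma AfunE (c : R) :
  Afun c d x =
  1 - c * (x ^+ 2 * inv_moment 2 d x - 2 * x * inv_moment 1 d x + 1).
Proof.
rewrite /Afun /inv_moment; congr (1 - c * _).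
rewrite -[X in _ = _ + X](sum_prop d).
rewrite !mulr_sumr -sumrN -!big_split /=; apply: eq_bigr => l _.
by have h := gap_neq0 l; field.
Qed.

Lemma weighted_varE :
  \sum_(l < levels d) prop d l * var d l / (x - var d l)
  = x * inv_moment 1 d x - 1.
Proof.
rewrite /inv_moment -[X in _ = _ - X](sum_prop d) mulr_sumr -sumrN -big_split /=.
by apply: eq_bigr => l _; have h := gap_neq0 l; field.
Qed.

(** Every squared gap grows to the right of the variances. *)
Lemma Afun_le (c y : R) : 0 < c -> x <= y -> Afun c d x <= Afun c d y.
Proof.
move=> hc xy; rewrite /Afun lerD2l lerN2 ler_pM2l //.
apply: ler_sum => l _.
have hl := gap_gt0 l.
have hy : x - var d l <= y - var d l by rewrite lerD2r.
rewrite ler_pM2l ?mulr_gt0 ?exprn_gt0 ?prop_gt0 ?var_gt0 //.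
rewrite lef_pV2 ?posrE ?exprn_gt0 //; last exact: lt_le_trans hy.
have hl2 := lt_le_trans hl hy.
by rewrite lerXn2r ?nnegrE ?(ltW hl) ?(ltW hl2).
Qed.

Lemma avg_var_lt : avg_var d < x.
Proof.
rewrite -subr_gt0 -[x]mulr1 -(sum_prop d) mulr_sumr -sumrN -big_split /=.
have l0 := Ordinal (levels_gt0 d).
have h l : 0 < x * prop d l - prop d l * var d l.
  by rewrite mulrC -mulrBr mulr_gt0 ?prop_gt0.
by rewrite (bigD1 l0) //= ltr_wpDr // sumr_ge0 // => l _; rewrite ltW.
Qed.

Lemma inv_moment1_ge : (x - avg_var d)^-1 <= inv_moment 1 d x.
Proof.
have gapE : x - avg_var d = \sum_(l < levels d) prop d l * (x - var d l).
  rewrite -[x in LHS]mulr1 -(sum_prop d) mulr_sumr -sumrN -big_split /=.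
  by apply: eq_bigr => l _; ring.
have gap_pos : 0 < x - avg_var d by rewrite subr_gt0 avg_var_lt.
set m := x - avg_var d in gapE gap_pos *.
have mN0 : m != 0 by rewrite gt_eqF.
(* Jensen: compare y^-1 with its tangent line at m. *)
have -> : m^-1 =
    \sum_(l < levels d) prop d l * (2 / m - (x - var d l) / m ^+ 2).
  rewrite (eq_bigr (fun l => prop d l * (2 / m) -
                              prop d l * (x - var d l) / m ^+ 2)); last first.
    by move=> l _; ring.
  rewrite big_split /= sumrN -!mulr_suml -gapE sum_prop.
  by field.
apply: ler_sum => l _; rewrite ler_pM2l ?prop_gt0 // expr1 -subr_ge0.
have g0 := gap_gt0 l; have gN0 := gap_neq0 l.
have -> : (x - var d l)^-1 - (2 / m - (x - var d l) / m ^+ 2) =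
          (x - var d l - m) ^+ 2 / (m ^+ 2 * (x - var d l)).
  by field; apply/andP; split.
by rewrite divr_ge0 ?sqr_ge0 // mulr_ge0 ?sqr_ge0 ?ltW.
Qed.

End AboveVariances.

(** Jensen for the square, through its tangent at the mean [m]: each [y = (x - v)^-1] satisfies
    [y^2 >= 2my - m^2]. *)
Lemma sqr_inv_moment1_le (R : realType) (d : noise_distr R) (x : R) :
  inv_moment 1 d x ^+ 2 <= inv_moment 2 d x.
Proof.
set m := inv_moment 1 d x.
have -> : m ^+ 2 = \sum_(l < levels d)
    prop d l * (2 * m * (x - var d l)^-1 - m ^+ 2).
  rewrite (eq_bigr (fun l => 2 * m * (prop d l * (x - var d l)^-1 ^+ 1) -
                              prop d l * m ^+ 2)); last by move=> l _; ring.
  rewrite big_split /= sumrN -mulr_suml -mulr_sumr sum_prop -/(inv_moment 1 d x) -/m.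
  by ring.
apply: ler_sum => l _; rewrite ler_pM2l ?prop_gt0 // -subr_ge0.
by have := sqr_ge0 ((x - var d l)^-1 - m); rewrite sqrrB; lra.
Qed.

(** * Existence and location of [beta] *)

Lemma exists_Bfun_root (R : realType) (c theta : R) (d : noise_distr R) :
  0 < c -> 0 < theta ->
  exists2 x, (forall l, var d l < x) & Bfun c theta d x = 0.
Proof.
move=> hc ht; have [l0 hl0] := exists_max_var R d.
have ct0 : 0 < c * theta ^+ 2 by rewrite mulr_gt0 ?exprn_gt0.
set k := c * theta ^+ 2 in ct0.
have p0 := prop_gt0 l0.
have p1 : prop d l0 <= 1.
  rewrite -(sum_prop d) (bigD1 l0) //= lerDl sumr_ge0 // => l _.
  by rewrite ltW ?prop_gt0.
(* The term of the largest variance alone gives B(a) <= 0, and all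
   denominators at b are at least k, whence B(b) >= 0. *)
pose a := var d l0 + k * prop d l0; pose b := var d l0 + k.
have ab : a <= b by rewrite lerD2l ler_piMr // ltW.
have ha l : var d l < a.
  by apply: le_lt_trans (hl0 l) _; rewrite ltrDl mulr_gt0.
have Ba : Bfun c theta d a <= 0.
  rewrite /Bfun -/k subr_le0 (bigD1 l0) //= mulrDr.
  have -> : k * (prop d l0 / (a - var d l0)) = 1.
    by rewrite /a addrAC subrr add0r; field; rewrite !gt_eqF.
  rewrite lerDl mulr_ge0 ?(ltW ct0) // sumr_ge0 // => l _.
  by rewrite divr_ge0 ?subr_ge0 ?(ltW (ha l)) ?(ltW (prop_gt0 l)).
have Bb : 0 <= Bfun c theta d b.
  rewrite /Bfun -/k subr_ge0.
  have -> : 1 = k * \sum_(l < levels d) prop d l / k.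
    by rewrite -mulr_suml sum_prop; field; rewrite gt_eqF.
  rewrite ler_pM2l //; apply: ler_sum => l _.
  rewrite ler_pM2l ?prop_gt0 // lef_pV2 ?posrE //.
    by rewrite /b; have := hl0 l; lra.
  by rewrite subr_gt0 (lt_le_trans (ha l)).
have cont : {within `[a, b], continuous (Bfun c theta d)}%classic.
  apply: derivable_within_continuous => x; rewrite in_itv /= => /andP[ax _].
  have hx l : x != var d l by rewrite gt_eqF // (lt_le_trans (ha l)).
  by have h := is_derive_Bfun R c theta d x hx; exact: ex_derive.
have [|x] := @IVT _ _ _ _ 0 ab cont.
  by rewrite ge_min Ba le_max Bb orbT.
rewrite in_itv /= => /andP[ax _] Bx; exists x => // l.
exact: lt_le_trans (ha l) ax.
Qed.

Lemma inv_moment1_lt (R : realType) (d : noise_distr R) (x y : R) :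
  (forall l, var d l < x) -> x < y -> inv_moment 1 d y < inv_moment 1 d x.
Proof.
move=> hx xy; apply: ltr_sum => [|l _].
  by apply/hasP; exists (Ordinal (levels_gt0 d)); rewrite // mem_index_enum.
have hl := hx l.
rewrite ltr_pM2l ?prop_gt0 // !expr1 ltf_pV2 ?posrE ?subr_gt0 ?ltrD2r //.
exact: lt_trans xy.
Qed.

(** B increases strictly above the variances, so the root found there is the largest. Everything
    later about [beta] rests on these two properties. *)
Lemma beta_spec (R : realType) (c theta : R) (d : noise_distr R) :
  0 < c -> 0 < theta ->
  (forall l, var d l < beta c theta d) /\
  c * theta ^+ 2 * inv_moment 1 d (beta c theta d) = 1.
Proof.
move=> hc ht; have [x hx Bx] := exists_Bfun_root R c theta d hc ht.
have ct0 : 0 < c * theta ^+ 2 by rewrite mulr_gt0 ?exprn_gt0.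
have rootx : real_root d (Bfun c theta d) x.
  by split=> // l; apply: neq_var.
have xmax y : real_root d (Bfun c theta d) y -> y <= x.
  case=> _ By; rewrite leNgt; apply/negP => xy.
  have := inv_moment1_lt _ _ _ _ hx xy.
  rewrite -(ltr_pM2l ct0); move: Bx By; rewrite !BfunE; lra.
(* The default value cannot occur, since [x] satisfies the defining predicate; a chosen [y] is at
   least [x], hence above every variance. *)
rewrite /beta /largest_real_root; case: xgetP => [y _ [[yv By] ymax]|/(_ x)[]//].
have xy := ymax _ rootx.
split=> [l|]; first by rewrite (lt_le_trans (hx l)).
by move: By; rewrite BfunE => /subr0_eq.
Qed.

(** At [beta] the first inverse moment is [1 / (c * theta ^+ 2)], which Jensen bounds below by
    [1 / (beta - avg_var d)]. *)
Lemma beta_ge (R : realType) (c theta : R) (d : noise_distr R) :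
  0 < c -> 0 < theta -> avg_var d + c * theta ^+ 2 <= beta c theta d.
Proof.
move=> hc ht; have [hv hb] := beta_spec _ _ _ d hc ht.
have ct0 : 0 < c * theta ^+ 2 by rewrite mulr_gt0 ?exprn_gt0.
have h := inv_moment1_ge _ _ _ hv.
have g : 0 < beta c theta d - avg_var d by rewrite subr_gt0 avg_var_lt.
move: h; rewrite -(ler_pM2l ct0) hb ler_pdivrMr // mul1r; lra.
Qed.

(** * The homoscedastic case *)

Lemma homoscedastic_inv_moment (R : realType) (s : R) (d : noise_distr R) k x :
  homoscedastic s d -> inv_moment k d x = (x - s)^-1 ^+ k.
Proof.
move=> hd; rewrite /inv_moment.
under eq_bigr do rewrite hd.
by rewrite -mulr_suml sum_prop mul1r.
Qed.

Lemma homoscedastic_avg_var (R : realType) (s : R) (d : noise_distr R) :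
  homoscedastic s d -> avg_var d = s.
Proof.
move=> hd; rewrite /avg_var.
under eq_bigr do rewrite hd.
by rewrite -mulr_suml sum_prop mul1r.
Qed.

(** With a single variance the root equation reads [c * theta ^+ 2 / (beta - s) = 1]. *)
Lemma homoscedastic_beta (R : realType) (c theta s : R) (d : noise_distr R) :
  0 < c -> 0 < theta -> homoscedastic s d ->
  beta c theta d = s + c * theta ^+ 2.
Proof.
move=> hc ht hd; have [hv] := beta_spec _ _ _ d hc ht.
rewrite (homoscedastic_inv_moment _ _ _ _ _ hd) expr1.
have hg : 0 < beta c theta d - s.
  by rewrite subr_gt0 -(hd (Ordinal (levels_gt0 d))).
move=> /(canRL (mulfVK _)); rewrite gt_eqF // mul1r => /(_ isT); lra.
Qed.

(** * A, T, R and S expressed through b and Q *)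

Lemma inv_moment1_beta (R : realType) (c theta : R) (d : noise_distr R) :
  0 < c -> 0 < theta ->
  inv_moment 1 d (beta c theta d) = (c * theta ^+ 2)^-1.
Proof.
move=> hc ht; have [_ hb] := beta_spec _ _ _ d hc ht.
have ctN0 : c * theta ^+ 2 != 0 by rewrite mulf_neq0 ?expf_neq0 ?gt_eqF.
by apply: (mulfI ctN0); rewrite hb mulfV.
Qed.

Lemma Afun_beta (R : realType) (c theta : R) (d : noise_distr R) :
  0 < c -> 0 < theta ->
  let b := beta c theta d in
  Afun c d b =
  1 - c + 2 * b / theta ^+ 2 - c * b ^+ 2 * inv_moment 2 d b.
Proof.
move=> hc ht b; have [hv _] := beta_spec _ _ _ d hc ht.
rewrite AfunE // inv_moment1_beta // -/b.
by field; rewrite !gt_eqF.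
Qed.

Lemma inv_moment2_beta_ge (R : realType) (c theta : R) (d : noise_distr R) :
  0 < c -> 0 < theta ->
  (c * theta ^+ 2)^-1 ^+ 2 <= inv_moment 2 d (beta c theta d).
Proof.
by move=> hc ht; rewrite -(inv_moment1_beta _ _ _ d hc ht) sqr_inv_moment1_le.
Qed.

Lemma homoscedastic_inv_moment2_beta (R : realType) (c theta s : R)
    (d : noise_distr R) :
  0 < c -> 0 < theta -> homoscedastic s d ->
  inv_moment 2 d (beta c theta d) = (c * theta ^+ 2)^-1 ^+ 2.
Proof.
move=> hc ht hd; rewrite (homoscedastic_inv_moment _ _ _ _ _ hd).
by rewrite (homoscedastic_beta _ _ _ _ _ hc ht hd) addrAC subrr add0r.
Qed.

(** A is nondecreasing from [beta] on, so positivity at [beta] excludes any root of A beyond it. *)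
Lemma max_alpha_beta (R : realType) (c theta : R) (d : noise_distr R) :
  0 < c -> 0 < theta -> 0 < Afun c d (beta c theta d) ->
  Num.max (alpha c d) (beta c theta d) = beta c theta d.
Proof.
move=> hc ht hA; have [hv _] := beta_spec _ _ _ d hc ht.
(* If A had no root, alpha would be the default 0, still below beta. *)
apply/max_idPr; rewrite leNgt; apply/negP.
rewrite /alpha /largest_real_root; case: xgetP => [a _ [[_ Aa] _] ba|_ b0].
  by have := Afun_le _ _ _ hv _ _ hc (ltW ba); rewrite Aa leNgt hA.
have := lt_trans (hv (Ordinal (levels_gt0 d))) b0.
by rewrite ltNge ltW ?var_gt0.
Qed.

(** T contains only first powers of inverse gaps, so it depends on the distribution through [beta]
    alone. *)
Lemma pca_amplitudeE (R : realType) (c theta : R) (d : noise_distr R) :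
  0 < c -> 0 < theta -> 0 < Afun c d (beta c theta d) ->
  let b := beta c theta d in
  pca_amplitude c theta d = c^-1 * b * (1 - c + b / theta ^+ 2).
Proof.
move=> hc ht hA b; rewrite /pca_amplitude max_alpha_beta //.
have [hv _] := beta_spec _ _ _ d hc ht.
rewrite weighted_varE // inv_moment1_beta // -/b.
by field; rewrite !gt_eqF.
Qed.

(** The form is affine in the inverse of Q, so that an upper bound on that inverse carries over to
    R. *)
Lemma subspace_recoveryE (R : realType) (c theta : R) (d : noise_distr R) :
  0 < c -> 0 < theta ->
  let b := beta c theta d in
  0 < b ->
  subspace_recovery c theta d =
  (1 - c + 2 * b / theta ^+ 2) / (b * (c * theta ^+ 2)) * (inv_moment 2 d b)^-1
  - b / theta ^+ 2.
Proof.
move=> hc ht b b0; have [hv _] := beta_spec _ _ _ d hc ht.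
have Q0 : 0 < inv_moment 2 d b.
  apply: lt_le_trans (inv_moment2_beta_ge _ _ _ d hc ht).
  by rewrite exprn_gt0 ?invr_gt0 ?mulr_gt0 ?exprn_gt0.
rewrite /subspace_recovery Afun_beta // derive1_Bfun -/b; last exact: neq_var.
by field; rewrite !gt_eqF.
Qed.

Lemma coef_recoveryE (R : realType) (c theta : R) (d : noise_distr R) :
  0 < c -> 0 < theta ->
  let b := beta c theta d in
  let u := b + (1 - c) * theta ^+ 2 in
  0 < u ->
  coef_recovery c theta d =
  (1 - c + 2 * b / theta ^+ 2) / (c ^+ 2 * theta ^+ 2 * u) *
    (inv_moment 2 d b)^-1
  - b ^+ 2 / (c * theta ^+ 2 * u).
Proof.
move=> hc ht b u u0; have [hv _] := beta_spec _ _ _ d hc ht.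
have Q0 : 0 < inv_moment 2 d b.
  apply: lt_le_trans (inv_moment2_beta_ge _ _ _ d hc ht).
  by rewrite exprn_gt0 ?invr_gt0 ?mulr_gt0 ?exprn_gt0.
rewrite /coef_recovery Afun_beta // derive1_Bfun -/b -/u; last exact: neq_var.
by field; rewrite !gt_eqF.
Qed.

(** * Monotonicity in b once Q is replaced by its lower bound *)

(** The bound simplifies to [2c + c(1 - c)t/b - b/t]. For [c > 1] the middle term increases with
    [b]; the condition [ct <= b0] lets the last one dominate. *)
Lemma subspace_bound_antitone (R : realFieldType) (c t b0 b : R) :
  0 < c -> 0 < t -> c * t <= b0 -> b0 <= b ->
  (1 - c + 2 * b / t) / (b * (c * t)) * ((c * t)^-1 ^+ 2)^-1 - b / t <=
  (1 - c + 2 * b0 / t) / (b0 * (c * t)) * ((c * t)^-1 ^+ 2)^-1 - b0 / t.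
Proof.
move=> hc ht ctb0 b0b.
have ct0 : 0 < c * t by rewrite mulr_gt0.
have b00 : 0 < b0 by apply: lt_le_trans ctb0.
have bp : 0 < b by apply: lt_le_trans b0b.
rewrite -subr_ge0.
set z := (X in 0 <= X).
have -> : z = (b - b0) * (b * b0 + c * (1 - c) * t ^+ 2) / (t * b * b0).
  by rewrite /z; field; rewrite !gt_eqF.
rewrite divr_ge0 ?mulr_ge0 ?subr_ge0 // ?(ltW ht) ?(ltW bp) ?(ltW b00) //.
(* This absorbs the term [- c^2 t^2] of the numerator and leaves at least [c t^2]. *)
have : (c * t) * (c * t) <= b * b0.
  by rewrite ler_pM ?(ltW ct0) ?(le_trans ctb0 b0b).
have : 0 < c * t ^+ 2 by rewrite mulr_gt0 ?exprn_gt0.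
lra.
Qed.

(** In terms of [u = b + (1 - c)t] the bound is [2/c - u/(ct) - (1 - c)t/(cu)], which decreases
    where [u^2 >= (1 - c)t^2]; the condition [ct <= b] says [u >= t], which suffices. *)
Lemma coef_bound_antitone (R : realFieldType) (c t b0 b : R) :
  0 < c -> 0 < t -> c * t <= b0 -> b0 <= b ->
  (1 - c + 2 * b / t) / (c ^+ 2 * t * (b + (1 - c) * t)) * ((c * t)^-1 ^+ 2)^-1
    - b ^+ 2 / (c * t * (b + (1 - c) * t)) <=
  (1 - c + 2 * b0 / t) / (c ^+ 2 * t * (b0 + (1 - c) * t)) *
    ((c * t)^-1 ^+ 2)^-1 - b0 ^+ 2 / (c * t * (b0 + (1 - c) * t)).
Proof.
move=> hc ht ctb0 b0b.
have tu0 : t <= b0 + (1 - c) * t by lra.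
have tu : t <= b + (1 - c) * t by lra.
have u00 := lt_le_trans ht tu0; have up := lt_le_trans ht tu.
rewrite -subr_ge0.
set z := (X in 0 <= X).
have -> : z = (b - b0) * ((b + (1 - c) * t) * (b0 + (1 - c) * t)
              - (1 - c) * t ^+ 2)
            / (c * t * (b + (1 - c) * t) * (b0 + (1 - c) * t)).
  by rewrite /z; field; rewrite !gt_eqF.
rewrite divr_ge0 ?mulr_ge0 ?(ltW hc) ?(ltW ht) ?(ltW up) ?(ltW u00) //.
  by rewrite subr_ge0.
have : t * t <= (b + (1 - c) * t) * (b0 + (1 - c) * t).
  by rewrite ler_pM ?(ltW ht).
have : 0 < c * t ^+ 2 by rewrite mulr_gt0 ?exprn_gt0.
lra.
Qed.

(** * Comparison with homoscedastic noise *)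

Lemma Afun_beta_le (R : realType) (c theta s : R) (d d0 : noise_distr R) :
  0 < c -> 0 < theta -> 0 < s -> avg_var d = s -> homoscedastic s d0 ->
  Afun c d (beta c theta d) <= Afun c d0 (beta c theta d0).
Proof.
move=> hc ht hs hd hd0.
have := beta_ge _ _ _ d hc ht; rewrite hd.
rewrite !Afun_beta // (homoscedastic_inv_moment2_beta _ _ _ _ _ hc ht hd0).
rewrite (homoscedastic_beta _ _ _ _ _ hc ht hd0).
have := inv_moment2_beta_ge _ _ _ d hc ht.
set b := beta c theta d; set Q := inv_moment 2 d b.
have t0 : 0 < theta ^+ 2 by rewrite exprn_gt0.
set t := theta ^+ 2 in t0 *; set q := (_^-1 ^+ 2) => qQ hb.
have cb0 : 0 <= c * b ^+ 2 by rewrite mulr_ge0 ?sqr_ge0 ?ltW.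
have le1 := ler_wpM2l cb0 qQ.
(* Completing the square shows that the bound on A decreases for [x >= ct]. *)
have sq x : 1 - c + 2 * x / t - c * x ^+ 2 * q =
            1 - (x - c * t) ^+ 2 / (c * t ^+ 2).
  by rewrite /q; field; rewrite !gt_eqF.
apply: (@le_trans _ _ (1 - c + 2 * b / t - c * b ^+ 2 * q)); first by lra.
rewrite !sq lerD2l lerN2 ler_pM2r; last first.
  by rewrite invr_gt0 mulr_gt0 ?exprn_gt0.
(* The squared quantities are [s] on the homoscedastic side and at least [s] on the other, hence
   both nonnegative. *)
by rewrite lerXn2r ?nnegrE; lra.
Qed.

(** Variances may repeat, so homoscedastic noise has many encodings [d0]; each of them is
    covered. *)
Theorem theorem2 (R : realType) (c theta s : R)
    (hc : 0 < c) (htheta : 0 < theta) (hs : 0 < s) :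
  (exists d : noise_distr R, admissible c theta s d) ->
  forall d0 : noise_distr R, homoscedastic s d0 ->
  admissible c theta s d0 /\
  forall d : noise_distr R, admissible c theta s d ->
    [/\ pca_amplitude c theta d0 <= pca_amplitude c theta d,
        1 < pca_amplitude c theta d0 / theta ^+ 2
          <= pca_amplitude c theta d / theta ^+ 2,
        subspace_recovery c theta d <= subspace_recovery c theta d0 &
        coef_recovery c theta d <= coef_recovery c theta d0].
Proof.
case=> d1 [hd1 hA1] d0 hd0.
have A0 := lt_le_trans hA1 (Afun_beta_le _ _ _ _ _ _ hc htheta hs hd1 hd0).
split; first by split=> //; exact: homoscedastic_avg_var.
move=> d [hd hA].
have t0 : 0 < theta ^+ 2 by rewrite exprn_gt0.
have b0E := homoscedastic_beta _ _ _ _ _ hc htheta hd0.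
have b0b : beta c theta d0 <= beta c theta d.
  by rewrite b0E -hd beta_ge.
have ct0 : 0 < c * theta ^+ 2 by rewrite mulr_gt0.
have ctb0 : c * theta ^+ 2 <= beta c theta d0 by rewrite b0E; lra.
have ctb := le_trans ctb0 b0b.
have b0p := lt_le_trans ct0 ctb0; have bp := lt_le_trans ct0 ctb.
have Tle : pca_amplitude c theta d0 <= pca_amplitude c theta d.
  rewrite !pca_amplitudeE //.
  (* This makes the factor [1 - c + b / theta ^+ 2] at least 1, so T is a product of nonnegative
     increasing factors. *)
  have c_le : c <= beta c theta d0 / theta ^+ 2 by rewrite ler_pdivlMr.
  have bt_le : beta c theta d0 / theta ^+ 2 <= beta c theta d / theta ^+ 2.
    by rewrite ler_pM2r ?invr_gt0.
  apply: ler_pM; rewrite ?mulr_ge0 ?invr_ge0 ?(ltW hc) ?(ltW b0p) //.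
  - lra.
  - by rewrite ler_pM2l ?invr_gt0.
  - lra.
(* The sign of the coefficient of the inverse of Q in both R and S. *)
have N0 : 0 <= 1 - c + 2 * beta c theta d / theta ^+ 2.
  have : c <= beta c theta d / theta ^+ 2 by rewrite ler_pdivlMr.
  lra.
have Qle : (inv_moment 2 d (beta c theta d))^-1 <=
           ((c * theta ^+ 2)^-1 ^+ 2)^-1.
  have q0 : 0 < (c * theta ^+ 2)^-1 ^+ 2 by rewrite exprn_gt0 ?invr_gt0.
  have Qq := inv_moment2_beta_ge _ _ _ d hc htheta.
  by rewrite lef_pV2 ?posrE ?(lt_le_trans q0).
split=> //.
- rewrite [X in _ && X]ler_pM2r ?invr_gt0 // Tle andbT.
  rewrite pca_amplitudeE // b0E.
  (* The ratio factors as [(1 + s/(ct)) (1 + s/t)] with [t = theta ^+ 2]; expanding isolates the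
     positive bias. *)
  have -> : c^-1 * (s + c * theta ^+ 2) *
      (1 - c + (s + c * theta ^+ 2) / theta ^+ 2) / theta ^+ 2 = 1 + (s / (c * theta ^+ 2) + s / theta ^+ 2
                          + s / (c * theta ^+ 2) * (s / theta ^+ 2)).
    by field; rewrite !gt_eqF.
  by rewrite ltrDl !addr_gt0 ?mulr_gt0 ?invr_gt0 ?mulr_gt0.
- rewrite !subspace_recoveryE //.
  rewrite (homoscedastic_inv_moment2_beta _ _ _ _ _ hc htheta hd0).
  (* The intermediate value keeps [beta] of [d] but takes Q from homoscedastic noise. *)
  apply: le_trans (subspace_bound_antitone _ _ _ _ _ hc t0 ctb0 b0b).
  by rewrite lerD2r ler_wpM2l // divr_ge0 // mulr_ge0 ?(ltW bp) ?(ltW ct0).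
- have u0 (b : R) : c * theta ^+ 2 <= b -> 0 < b + (1 - c) * theta ^+ 2 by lra.
  rewrite !coef_recoveryE ?u0 //.
  rewrite (homoscedastic_inv_moment2_beta _ _ _ _ _ hc htheta hd0).
  apply: le_trans (coef_bound_antitone _ _ _ _ _ hc t0 ctb0 b0b).
  rewrite lerD2r ler_wpM2l // divr_ge0 //.
  by rewrite !mulr_ge0 ?exprn_ge0 ?(ltW hc) ?(ltW htheta) ?(ltW (u0 _ ctb)).
Qed.
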